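(* Let $\theta \in (0,1)\setminus\mathbb{Q}$ have continued fraction expansion $$\theta = \cfrac{1}{a_1+\cfrac{1}{a_2+\cfrac{1}{\ddots}}}$$ with $a_j$ a positive integer for all $j$, fix a nondegenerate interval $I \subseteq \mathbb{T} = \mathbb{R}/\mathbb{Z}$, and let $\beta\neq\gamma$ in $\mathbb{D}$. If $\limsup_{j\to\infty} a_j \geq 4$, then for Lebesgue almost every $\varphi\in[0,1)$ the extended CMV matrix $\mathcal{E}^I_{\theta,\varphi}$ has purely continuous spectrum (that is, it has no eigenvalues).
   Context: $\mathbb{D} = \{z \in \mathbb{C} : |z|<1\}$. Given $\alpha = (\alpha_n)_{n\in\mathbb{Z}}$ with $\alpha_n \in \mathbb{D}$ (the Verblunsky coefficients), the corresponding extended CMV matrix is the unitary operator $\mathcal{E} = \mathcal{L}\mathcal{M}$ on $\ell^2(\mathbb{Z})$, where $$\mathcal{L} = \bigoplus_{j\in\mathbb{Z}} \Theta(\alpha_{2j}),\quad \mathcal{M} = \bigoplus_{j\in\mathbb{Z}} \Theta(\alpha_{2j+1}),\quad \Theta(\alpha) = \begin{pmatrix} \overline{\alpha} & \rho \\ \rho & -\alpha\end{pmatrix},\quad \rho = \sqrt{1-|\alpha|^2},$$ and $\Theta(\alpha_n)$ acts on $\ell^2(\{n,n+1\})$. For $\theta\in(0,1)\setminus\mathbb{Q}$, $\varphi\in[0,1)$ and a nondegenerate interval (i.e. an interval of positive length) $I\subseteq\mathbb{T}$, the rotation coding sequence is $u(n) = \chi_I(n\theta+\varphi)$, $n\in\mathbb{Z}$,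 where $\chi_I$ is the indicator function of $I$ and $n\theta+\varphi$ is taken modulo $1$. The operator $\mathcal{E}^I_{\theta,\varphi}$ is the extended CMV matrix with Verblunsky coefficients $\alpha^I_{\theta,\varphi}(n) = \beta$ if $u(n)=0$ and $\alpha^I_{\theta,\varphi}(n)=\gamma$ if $u(n)=1$. *)

(* Defs.v *)
From HB Require Import structures.
From mathcomp Require Import all_boot all_order all_algebra.
From mathcomp Require Import all_classical all_reals all_analysis.
From mathcomp Require Import complex.

Set Implicit Arguments.
Unset Strict Implicit.
Unset Printing Implicit Defensive.

Import Order.TTheory GRing.Theory Num.Theory numFieldNormedType.Exports.

Local Open Scope classical_set_scope.
Local Open Scope ring_scope.

Section CMV.
Variable R : realType.
Local Notation C := R[i].

Definition rho (a : C) : C := sqrtC (1 - `|a| ^+ 2).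

Definition Theta (a : C) : 'M[C]_2 :=
  block_mx (a^*)%:M (rho a)%:M (rho a)%:M (- a)%:M :> 'M[C]_(1 + 1).

(* [Theta_sum alpha p] is the direct sum of the blocks [Theta (alpha n)], each
   acting on the coordinates [n] and [n + 1], over the integers [n] congruent
   to [p] modulo 2: coordinate [n] is the first one of its block if
   [n = p %[mod 2]] and the second one of the block at [n - 1] otherwise.
   It is defined on all sequences; l^2(Z) is an invariant subspace. *)
Definition Theta_sum (alpha : int -> C) (p : int) (psi : int -> C) : int -> C :=
  fun n =>
    if (n == p %[mod 2])%Z then
      Theta (alpha n) 0 0 * psi n + Theta (alpha n) 0 1 * psi (n + 1)
    else
      Theta (alpha (n - 1)) 1 0 * psi (n - 1) + Theta (alpha (n - 1)) 1 1 * psi n.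

Definition cmvL (alpha : int -> C) := Theta_sum alpha 0.

Definition cmvM (alpha : int -> C) := Theta_sum alpha 1.

Definition extended_CMV (alpha : int -> C) : (int -> C) -> (int -> C) :=
  cmvL alpha \o cmvM alpha.

Definition ell2 : set (int -> C) :=
  [set psi | summable [set: int] (fun n => (Normc.normc (psi n) ^+ 2)%:E)].

Definition ell2_eigenvalue (T : (int -> C) -> (int -> C)) (z : C) : Prop :=
  exists psi : int -> C,
    [/\ ell2 psi, (exists n, psi n != 0) & forall n, T psi n = z * psi n].

Definition purely_continuous_spectrum (T : (int -> C) -> (int -> C)) : Prop :=
  forall z : C, ~ ell2_eigenvalue T z.

(* The circle R/Z is represented by its fundamental domain [0, 1[, the
   projection R -> R/Z being [mod1]. *)
Definition mod1 (x : R) : R := x - (Num.floor x)%:~R.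

(* Intervals of the circle are the images of intervals of the line; they may
   wrap around 0, and contain or not either endpoint. *)
Definition nondegenerate_circle_interval (I : set R) : Prop :=
  exists J : set R,
    [/\ is_interval J, (exists x y, [/\ J x, J y & x < y]) & I = mod1 @` J].

Definition rotation_coding (theta phi : R) (I : set R) (n : int) : R :=
  \1_I (mod1 (n%:~R * theta + phi)).

Definition coding_verblunsky (theta phi : R) (I : set R) (beta gamma : C)
    (n : int) : C :=
  if rotation_coding theta phi I n == 0 then beta else gamma.

Fixpoint contfrac (s : seq nat) : R :=
  if s is a :: s' then (a%:R + contfrac s')^-1 else 0.

(* [a 0] plays no role: the partial quotients are [a 1], [a 2], ... *)
Definition has_contfrac_expansion (theta : R) (a : nat -> nat) : Prop :=
  (forall j, (0 < j)%N -> (0 < a j)%N) /\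
  (fun n => contfrac [seq a j | j <- iota 1 n]) @ \oo --> theta.

End CMV.

(* Main.v *)
(* An eigenvector [psi] for [z], together with [phi = M psi], gives a decaying
   solution of a cocycle of 2x2 matrices of determinant 1 over the Verblunsky
   coefficients; Gordon's three-block argument forces it to vanish as soon as,
   for infinitely many [q], the coding satisfies [u (n + q) = u n] for
   [- q < n <= q].

   Take for [q] the denominators of the convergents [p / q] of [theta] just
   before a large partial quotient, so that [q |q theta - p| <= kappa] with
   [kappa < 1/4]. The phases for which one of the [2 q] equalities fails lie
   within [|q theta - p| / 2] of translates of two points by multiples of
   [theta], and since these translates are well spread, they occupy a
   proportion at most [4 kappa + o(1) < 1] of every interval. Hence the phases
   that are bad for all large [q] form a set of density less than 1 in every
   interval, and such a set is null. This local estimate replaces the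
   ergodicity of the rotation. *)
Require Import Defs.
From HB Require Import structures.
From mathcomp Require Import all_boot all_order all_algebra.
From mathcomp Require Import all_classical all_reals all_analysis.
From mathcomp Require Import measurable_realfun complex ring lra zify.
Set Implicit Arguments.
Unset Strict Implicit.
Unset Printing Implicit Defensive.
Import Order.TTheory GRing.Theory Num.Theory numFieldNormedType.Exports.
Local Open Scope classical_set_scope.
Local Open Scope ring_scope.

(** * The three-block Gordon argument *)

Lemma det_mx22 (K : comNzRingType) (A : 'M[K]_2) :
  \det A = A 0 0 * A 1 1 - A 0 1 * A 1 0.
Proof.
rewrite (expand_det_row _ 0) !big_ord_recl big_ord0 addr0 /cofactor !det_mx11.
rewrite !mxE /= expr0 mul1r expr1 mulN1r mulrN.
by congr (_ * A _ _ - A _ _ * A _ _); apply/val_inj.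
Qed.

Lemma mxtrace22 (K : comNzRingType) (A : 'M[K]_2) : \tr A = A 0 0 + A 1 1.
Proof.
rewrite /mxtrace !big_ord_recl big_ord0 addr0.
by congr (_ + A _ _); apply/val_inj.
Qed.

Lemma mulmx22E (K : comNzRingType) m (A : 'M[K]_2) (B : 'M[K]_(2, m)) i j :
  (A *m B) i j = A i 0 * B 0 j + A i 1 * B 1 j.
Proof.
rewrite !mxE !big_ord_recl big_ord0 addr0.
by congr (_ + A _ _ * B _ _); apply/val_inj.
Qed.

Lemma forall_ord2 (P : 'I_2 -> Prop) : P 0 -> P 1 -> forall i, P i.
Proof.
move=> P0 P1 [[|[|//]] Hi].
- by rewrite (_ : Ordinal _ = 0) //; apply/val_inj.
- by rewrite (_ : Ordinal _ = 1) //; apply/val_inj.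
Qed.

Lemma Cayley_Hamilton22 (K : comNzRingType) (T : 'M[K]_2) (v : 'cV[K]_2) :
  \det T = 1 -> T *m (T *m v) + v = \tr T *: (T *m v).
Proof.
rewrite det_mx22 mxtrace22 => dT; apply/matrixP => i j.
rewrite [LHS]mxE [RHS]mxE -[v i j]mul1r -dT !mulmx22E.
have [->|->] : i = 0 \/ i = 1 by move: i; apply: forall_ord2; [left|right].
  by ring.
by ring.
Qed.

Definition l1norm (K : numDomainType) (v : 'cV[K]_2) : K := `|v 0 0| + `|v 1 0|.

Lemma l1norm_ge0 (K : numDomainType) (v : 'cV[K]_2) : 0 <= l1norm v.
Proof. by rewrite addr_ge0. Qed.

Lemma l1normZ (K : numDomainType) a (v : 'cV[K]_2) :
  l1norm (a *: v) = `|a| * l1norm v.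
Proof. by rewrite /l1norm !mxE !normrM mulrDr. Qed.

Lemma ler_l1normD (K : numDomainType) (v w : 'cV[K]_2) :
  l1norm (v + w) <= l1norm v + l1norm w.
Proof. by rewrite /l1norm !mxE addrACA lerD // ler_normD. Qed.

(* By Cayley-Hamilton, [x = T v] is bounded by [T x] and [T^2 x] if
   [`|\tr T| <= 1], and by [T x] and [T^-1 x = v] otherwise. *)
Lemma Gordon_bound (K : numFieldType) (T : 'M[K]_2) (v : 'cV[K]_2) :
  \det T = 1 ->
  l1norm (T *m v) <= l1norm v + l1norm (T *m (T *m v))
                     + l1norm (T *m (T *m (T *m v))).
Proof.
move=> dT; set x := T *m v.
have tr_real : `|\tr T| \is Num.real by exact: normr_real.
case: (real_leP tr_real (@real1 K)) => tr1.
- have {1}-> : x = \tr T *: (T *m x) - T *m (T *m x).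
    by rewrite -(Cayley_Hamilton22 x dT) addrC addKr.
  rewrite (le_trans (ler_l1normD _ _)) // -scaleN1r !l1normZ normrN1 mul1r.
  rewrite lerD2r (le_trans (ler_piMl (l1norm_ge0 _) tr1)) //.
  by rewrite lerDr l1norm_ge0.
- rewrite ler_wpDr ?l1norm_ge0 // (le_trans (ler_peMl (l1norm_ge0 _) (ltW tr1))) //.
  rewrite -l1normZ -(Cayley_Hamilton22 v dT) addrC.
  exact: ler_l1normD.
Qed.

Section cocycle.
Variables (K : numFieldType) (S : int -> 'M[K]_2) (v : int -> 'cV[K]_2).
Hypothesis detS : forall n, \det (S n) = 1.
Hypothesis vS : forall n, v (n + 1) = S n *m v n.

Fixpoint transfer (m : int) (q : nat) : 'M[K]_2 :=
  if q is q'.+1 then S (m + q'%:Z) *m transfer m q' else 1%:M.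

Lemma det_transfer m q : \det (transfer m q) = 1.
Proof. by elim: q => [|q IH] /=; rewrite ?det1 // det_mulmx detS IH mul1r. Qed.

Lemma transferE m q : v (m + q%:Z) = transfer m q *m v m.
Proof.
elim: q => [|q IH] /=; first by rewrite addr0 mul1mx.
by rewrite -mulmxA -IH -vS -addrA intS [1 + _]addrC.
Qed.

Lemma eq_transfer m m' q :
  (forall j : nat, (j < q)%N -> S (m + j%:Z) = S (m' + j%:Z)) ->
  transfer m q = transfer m' q.
Proof.
elim: q => [//|q IH] /= eS; rewrite eS // IH // => j jq.
by rewrite eS // ltnW.
Qed.

(** The hypothesis ties the values of [S] on [1 - q, ..., 2 q] together: they form three equal
    consecutive blocks, so the four vectors are [x], [T x], [T^2 x], [T^3 x] for a single matrix
    [T]. *)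
Lemma three_block_bound q :
  (forall n : int, - q%:Z < n <= q%:Z -> S (n + q%:Z) = S n) ->
  l1norm (v 1) <= l1norm (v (1 - q%:Z)) + l1norm (v (1 + q%:Z))
                  + l1norm (v (1 + q%:Z + q%:Z)).
Proof.
move=> perS; set T := transfer (1 - q%:Z) q.
have e1 : transfer 1 q = T.
  apply: eq_transfer => j jq; rewrite -(perS (1 - q%:Z + j%:Z)).
    by congr S; lia.
  by lia.
have e2 : transfer (1 + q%:Z) q = T.
  rewrite -e1; apply: eq_transfer => j jq; rewrite -(perS (1 + j%:Z)).
    by congr S; lia.
  by lia.
have v1 : v 1 = T *m v (1 - q%:Z) by rewrite -transferE subrK.
have v2 : v (1 + q%:Z) = T *m v 1 by rewrite transferE e1.
have v3 : v (1 + q%:Z + q%:Z) = T *m v (1 + q%:Z) by rewrite transferE e2.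
rewrite v3 v2 v1; apply: Gordon_bound; exact: det_transfer.
Qed.

Lemma cocycle_eq0 m : v m = 0 -> forall n, v n = 0.
Proof.
move=> vm.
have up k : v (m + k%:Z) = 0 by rewrite transferE vm mulmx0.
have down k : v (m - k%:Z) = 0.
  have uT : transfer (m - k%:Z) k \in unitmx by rewrite unitmxE det_transfer unitr1.
  by rewrite -(mulKmx uT (v _)) -transferE subrK vm mulmx0.
move=> n; have [mn|nm] := leP m n.
- by have := up `|n - m|%N; rewrite (_ : m + _ = n) //; lia.
- by have := down `|m - n|%N; rewrite (_ : m - _ = n) //; lia.
Qed.

Lemma Gordon_three_block :
  (forall e : K, 0 < e -> exists N : nat, forall n : int,
     (N <= `|n|)%N -> l1norm (v n) < e) ->
  (forall N : nat, exists2 q : nat, (N <= q)%N &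
     forall n : int, - q%:Z < n <= q%:Z -> S (n + q%:Z) = S n) ->
  forall n, v n = 0.
Proof.
move=> decay per; apply: (@cocycle_eq0 1).
(* [N.+2] absorbs the offset of the base site 1: the site [1 - q] still has absolute value at least
   [N]. *)
have small e : 0 < e -> l1norm (v 1) < e *+ 3.
  move=> e0; have [N Nv] := decay _ e0; have [q Nq perq] := per N.+2.
  apply: le_lt_trans (three_block_bound perq) _.
  by rewrite mulrSr mulr2n !ltrD // Nv //; lia.
have v10 : l1norm (v 1) = 0.
  apply/eqP; apply: contraT => nz.
  have v1gt0 : 0 < l1norm (v 1) by rewrite lt_neqAle eq_sym nz l1norm_ge0.
  have := small (l1norm (v 1) / 3%:R) (divr_gt0 v1gt0 (ltr0n _ 3)).
  by rewrite -[ltRHS]mulr_natr mulfVK ?pnatr_eq0 // ltxx.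
move: v10 => /eqP; rewrite paddr_eq0 // !normr_eq0 => /andP[/eqP v0 /eqP v1].
apply/matrixP => i j; rewrite (ord1 j) mxE.
by move: i; apply: forall_ord2.
Qed.

End cocycle.

(** * Eigenvectors of extended CMV matrices *)

Definition vanishing (K : numDomainType) (f : int -> K) : Prop :=
  forall e : K, 0 < e -> exists N : nat, forall n : int, (N <= `|n|)%N -> `|f n| < e.

Lemma vanishingD (K : numFieldType) (f g : int -> K) :
  vanishing f -> vanishing g -> vanishing (fun n => f n + g n).
Proof.
move=> f0 g0 e e0; have e2 : 0 < e / 2 by rewrite divr_gt0.
have [Nf Hf] := f0 _ e2; have [Ng Hg] := g0 _ e2.
exists (maxn Nf Ng) => n; rewrite geq_max => /andP[/Hf hf /Hg hg].
by rewrite (le_lt_trans (ler_normD _ _)) // [e]splitr ltrD.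
Qed.

Lemma vanishing_dominated (K : numFieldType) (B : K) (f g : int -> K) : 0 < B ->
  (forall n, `|g n| <= B * `|f n|) -> vanishing f -> vanishing g.
Proof.
move=> B0 gf f0 e e0; have [N HN] := f0 _ (divr_gt0 e0 B0).
by exists N => n /HN; rewrite ltr_pdivlMr // mulrC; apply: le_lt_trans.
Qed.

Lemma vanishing_shift (K : numFieldType) (m : int) (f : int -> K) :
  vanishing f -> vanishing (fun n => f (n + m)).
Proof.
by move=> f0 e /f0[N HN]; exists (N + `|m|)%N => n ?; apply: HN; lia.
Qed.

(** Some finite set of sites carries more than the total sum minus [r^2]; adding to it a site where
    [|psi n| >= r] would exceed the total. *)
Lemma ell2_vanishing (R : realType) (psi : int -> R[i]) : ell2 psi -> vanishing psi.
Proof.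
pose a (n : int) : \bar R := (Normc.normc (psi n) ^+ 2)%:E.
have ae n : a n = (Normc.normc (psi n) ^+ 2)%:E by [].
have a0 n : (0 <= a n)%E by rewrite ae lee_fin sqr_ge0.
rewrite /ell2 /= /summable => sa e e0.
have {}sa : (\esum_(i in setT) a i < +oo)%E.
  by rewrite (eq_esum (b := fun n => `|a n|%E)) // => n _; rewrite gee0_abs.
have [r er] : exists r : R, e = r%:C%C.
  by exists (complex.Re e); rewrite RRe_real // ger0_real // ltW.
have r0 : 0 < r by move: e0; rewrite er ltcR.
have afin : \esum_(i in setT) a i \is a fin_num.
  rewrite ge0_fin_numE //; apply: esum_ge0 => n _.
  by rewrite ae lee_fin sqr_ge0.
have := ub_ereal_sup_adherent (exprn_gt0 2 r0) afin.
case=> _ [A [finA _] <-]; rewrite -/(esum _ _) => ltA.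
have [N AN] : exists N : nat, forall n, A n -> (`|n| < N)%N.
  have /finite_seqP[s ->] := finA.
  exists (\max_(n <- s) `|n|)%N.+1 => n sn; rewrite ltnS.
  exact: (@leq_bigmax_seq _ _ _ (fun n : int => `|n|%N)).
exists N => n Nn; have An : ~ A n by move/AN; lia.
suff : (a n < (r ^+ 2)%:E)%E.
  rewrite ae lte_fin ltr_pXn2r ?nnegrE ?(ltW r0) //; last first.
    by case: (psi n) => x y; exact: sqrtr_ge0.
  by rewrite er normc_def ltcR; case: (psi n).
have : (\sum_(x \in A `|` [set n]) a x <= \esum_(i in setT) a i)%E.
  apply: ereal_sup_ubound; exists (A `|` [set n]) => //.
  by split => //; rewrite finite_setU.
rewrite fsbigU //=; last by move=> x [Ax xn]; case: An; rewrite -xn.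
rewrite fsbig_set1 => leA.
have finsum : (\sum_(x \in A) a x)%E \is a fin_num.
  rewrite fsbig_finite //= sum_fin_num.
  by apply/allP => _ /mapP[i _ ->].
move: ltA; rewrite lteBlDr // => ltA.
by have := le_lt_trans leA ltA; rewrite lteD2lE.
Qed.

Section CMV_transfer.
Variable R : realType.
Local Notation C := R[i].
Implicit Types (a z w : C) (alpha psi : int -> C).

Lemma ThetaE a :
  (Theta a 0 0 = a^*) * (Theta a 0 1 = rho a) *
  (Theta a 1 0 = rho a) * (Theta a 1 1 = - a).
Proof.
pose B : 'M[C]_(1 + 1) := block_mx (a^*)%:M (rho a)%:M (rho a)%:M (- a)%:M.
have TB (i j : 'I_2) (i' j' : 'I_(1 + 1)) : i = i' :> nat -> j = j' :> nat ->
    Theta a i j = B i' j'.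
  by move=> ii' jj'; rewrite /Theta -/B; congr (B _ _); apply/val_inj.
do !split.
- by rewrite (TB _ _ (lshift 1 0) (lshift 1 0)) // block_mxEul mxE.
- by rewrite (TB _ _ (lshift 1 0) (rshift 1 0)) // block_mxEur mxE.
- by rewrite (TB _ _ (rshift 1 0) (lshift 1 0)) // block_mxEdl mxE.
- by rewrite (TB _ _ (rshift 1 0) (rshift 1 0)) // block_mxEdr mxE.
Qed.

Lemma rho_sqr a : rho a ^+ 2 = 1 - a * a^*.
Proof. by rewrite sqrtCK normCK. Qed.

Lemma rho_neq0 a : `|a| < 1 -> rho a != 0.
Proof.
move=> a1; rewrite sqrtC_eq0 subr_eq0 eq_sym lt_eqF //.
by rewrite exprn_ilt1.
Qed.

Lemma norm_rho_le1 a : `|a| < 1 -> `|rho a| <= 1.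
Proof.
move=> a1; rewrite -(@ler_pXn2r _ 2) ?nnegrE // -normrX sqrtCK expr1n.
rewrite ger0_norm; last by rewrite subr_ge0 exprn_ile1 // ltW.
by rewrite lerBlDr lerDl exprn_ge0.
Qed.

(* [w] stands for a square root of [z]. *)
Definition Szego_mx w (a : C) : 'M[C]_2 :=
  (w * rho a)^-1 *:
    \matrix_(i, j) if i == 0 then (if j == 0 then 1 else - a)
                   else (if j == 0 then - (w ^+ 2 * a^*) else w ^+ 2).

Lemma det_Szego_mx w a : w != 0 -> `|a| < 1 -> \det (Szego_mx w a) = 1.
Proof.
move=> w0 /rho_neq0 r0; rewrite det_mx22 !mxE /=.
have -> : (w * rho a)^-1 * 1 * ((w * rho a)^-1 * w ^+ 2)
  - (w * rho a)^-1 * - a * ((w * rho a)^-1 * - (w ^+ 2 * a^*))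
  = w ^+ 2 / (w ^+ 2 * rho a ^+ 2) * (1 - a * a^*).
  by field; rewrite w0 r0.
rewrite -rho_sqr; field; by rewrite w0 r0.
Qed.

(* The Gesztesy-Zinchenko transfer matrices depend on the parity of the site.
   Swapping [psi] and [phi = M psi] at even sites and rescaling turns all of
   them into Szego matrices, so that odd periods can be used as well. *)
Definition Szego_vec w alpha psi (n : int) : 'cV[C]_2 :=
  let phi := cmvM alpha psi in
  if (n == 1 %[mod 2])%Z then \col_i (if i == 0 then psi n else phi n)
  else w^-1 *: \col_i (if i == 0 then phi n else w ^+ 2 * psi n).

Variables (w : C) (alpha psi : int -> C).
Hypothesis w0 : w != 0.
Hypothesis alpha1 : forall n, `|alpha n| < 1.
Hypothesis eig : forall n, extended_CMV alpha psi n = w ^+ 2 * psi n.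

(** An odd [n] heads a block of [M], linking [psi] to [phi]; an even [n] heads a block of [L],
    linking [phi] to [w^2 psi] by the eigenvalue equation. Solving either block for its values at
    [n + 1] gives the same matrix. *)
Lemma Szego_vecS n :
  Szego_vec w alpha psi (n + 1) = Szego_mx w (alpha n) *m Szego_vec w alpha psi n.
Proof.
have r0 := rho_neq0 (alpha1 n); have rE := rho_sqr (alpha n).
have e0 := eig n; have e1 := eig (n + 1).
rewrite /extended_CMV /= /cmvL /Theta_sum in e0 e1.
set phi := cmvM alpha psi in e0 e1.
have f0 : phi n = cmvM alpha psi n by [].
have f1 : phi (n + 1) = cmvM alpha psi (n + 1) by [].
rewrite /cmvM /Theta_sum in f0 f1.
have aE : (alpha n) * (alpha n)^* = 1 - rho (alpha n) ^+ 2.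
  by rewrite rE opprB addrC subrK.
rewrite /Szego_vec -/phi; have [no|ne] := boolP (n == 1 %[mod 2])%Z.
- rewrite ifN; last by lia.
  move: f0 f1; rewrite no ifN; last by lia.
  rewrite addrK !ThetaE => f0 f1.
  apply/matrixP => i j; rewrite mulmx22E; move: i; apply: forall_ord2; rewrite !mxE /=.
  + rewrite f1 f0.
    (* Multiplying and dividing by [rho] brings out [rho^2], which [rE] expands; the even case uses
       the same device. *)
    have -> : rho (alpha n) * psi n + - alpha n * psi (n + 1) =
      (rho (alpha n) ^+ 2 * psi n - alpha n * rho (alpha n) * psi (n + 1)) / rho (alpha n).
      by field.
    by rewrite rE; field; rewrite w0 r0.
  + by rewrite f0; field; rewrite w0 r0.
- rewrite ifT; last by lia.
  move: e0 e1; rewrite ifT; last by lia.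
  rewrite ifN; last by lia.
  rewrite addrK !ThetaE => e0 e1.
  apply/matrixP => i j; rewrite mulmx22E; move: i; apply: forall_ord2; rewrite !mxE /=.
  + rewrite -e0.
    have -> : psi (n + 1) = w ^- 2 * (w ^+ 2 * psi (n + 1)) by field.
    rewrite -e1.
    have -> : rho (alpha n) * phi n + - alpha n * phi (n + 1) =
      (rho (alpha n) ^+ 2 * phi n - alpha n * rho (alpha n) * phi (n + 1)) / rho (alpha n).
      by field.
    by rewrite rE; field; rewrite w0 r0.
  + by rewrite -e0; field; rewrite w0 r0.
Qed.

Lemma Szego_vec_eq0 n : Szego_vec w alpha psi n = 0 -> psi n = 0.
Proof.
rewrite /Szego_vec; case: ifP => _ /matrixP E.
- by have := E 0 0; rewrite !mxE.
- have /eqP := E 1 0; rewrite !mxE /= mulf_eq0 invr_eq0 (negbTE w0) /=.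
  by rewrite mulf_eq0 expf_eq0 (negbTE w0) => /eqP.
Qed.

(** Each value of [M psi] combines two neighbouring values of [psi] with coefficients of modulus at
    most 1. *)
Lemma vanishing_cmvM : vanishing psi -> vanishing (cmvM alpha psi).
Proof.
move=> p0; have np0 : vanishing (fun n => `|psi n|).
  by move=> e /p0[N HN]; exists N => n /HN; rewrite normr_id.
apply: (@vanishing_dominated _ 1
  (fun n => `|psi n| + (`|psi (n + 1)| + `|psi (n + -1)|))) => //.
- move=> n; rewrite mul1r [leRHS]ger0_norm; last by rewrite !addr_ge0.
  have bd (c d x y : C) : `|c| <= 1 -> `|d| <= 1 -> `|c * x + d * y| <= `|x| + `|y|.
    move=> c1 d1; rewrite (le_trans (ler_normD _ _)) // !normrM lerD //;
    by rewrite ler_piMl.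
  rewrite /cmvM /Theta_sum !ThetaE; case: ifP => _.
  + apply: le_trans (bd _ _ _ _ _ _) _; [|exact: norm_rho_le1|by rewrite addrA lerDl].
    by rewrite norm_conjC ltW.
  + apply: le_trans (bd _ _ _ _ _ _) _; [exact: norm_rho_le1| |].
      by rewrite normrN ltW.
    by rewrite addrC lerD2l lerDr.
- apply: vanishingD => //; apply: vanishingD; exact: (vanishing_shift _ np0).
Qed.

Lemma vanishing_Szego_vec :
  vanishing psi -> vanishing (fun n => l1norm (Szego_vec w alpha psi n)).
Proof.
move=> p0; have q0 := vanishing_cmvM p0.
have nv f : vanishing f -> vanishing (fun n => `|f n : C|).
  by move=> f0 e /f0[N HN]; exists N => n /HN; rewrite normr_id.
pose B := 1 + `|w|^-1 + `|w|.
have B1 : 1 <= B by rewrite /B -addrA lerDl addr_ge0 ?invr_ge0.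
have Bw : `|w|^-1 <= B by rewrite /B addrAC lerDr addr_ge0.
have Bw' : `|w| <= B by rewrite /B lerDr addr_ge0 ?invr_ge0.
apply: (@vanishing_dominated _ B (fun n => `|psi n| + `|cmvM alpha psi n|)).
- exact: lt_le_trans B1.
- move=> n; rewrite ger0_norm ?l1norm_ge0 // [`|_ + _|]ger0_norm ?addr_ge0 //.
  rewrite /Szego_vec; case: ifP => _; rewrite /l1norm !mxE /=.
  + by rewrite ler_peMl // addr_ge0.
  + rewrite mulrA expr2 mulKf // !normrM normfV addrC mulrDr lerD //;
    by rewrite ler_wpM2r.
- by apply: vanishingD; exact: nv.
Qed.

End CMV_transfer.

(** Each block is unitary: applying its adjoint to the two zero values recovers the pair of entries
    of [psi]. *)
Lemma Theta_sum_eq0 (R : realType) (alpha psi : int -> R[i]) (p : int) :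
  (forall n, `|alpha n| < 1) ->
  (forall n, Theta_sum alpha p psi n = 0) -> forall n, psi n = 0.
Proof.
move=> alpha1 T0.
have block n : (n == p %[mod 2])%Z -> psi n = 0 /\ psi (n + 1) = 0.
  move=> np; have := T0 n; have := T0 (n + 1); rewrite /Theta_sum np ifN; last by lia.
  rewrite addrK !ThetaE; have rE := rho_sqr (alpha n); have r0 := rho_neq0 (alpha1 n).
  move=> h1 h0; split.
  - have -> : psi n = (1 - alpha n * (alpha n)^*) * psi n + alpha n * (alpha n)^* * psi n.
      by ring.
    rewrite -rE -[RHS](mulr0 (rho (alpha n))) -h1 -[RHS]addr0.
    rewrite -[X in _ = _ + X](mulr0 (alpha n)) -h0.
    by ring.
  - have -> : psi (n + 1) = (1 - alpha n * (alpha n)^*) * psi (n + 1)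
                            + alpha n * (alpha n)^* * psi (n + 1).
      by ring.
    rewrite -rE -[RHS](mulr0 (rho (alpha n))) -h0 -[RHS]subr0.
    rewrite -[X in _ = _ - X](mulr0 (alpha n)^*) -h1.
    by ring.
move=> n; have [/block[]//|np] := boolP (n == p %[mod 2])%Z.
by have [|_] := block (n - 1); [lia | rewrite subrK].
Qed.

Lemma Gordon_CMV (R : realType) (alpha : int -> R[i]) :
  (forall n, `|alpha n| < 1) ->
  (forall N : nat, exists2 q : nat, (N <= q)%N &
     forall n : int, - q%:Z < n <= q%:Z -> alpha (n + q%:Z) = alpha n) ->
  purely_continuous_spectrum (extended_CMV alpha).
Proof.
move=> alpha1 per z [psi [psi2 [m psim] eig]].
(* The Szego matrices divide by a square root of [z], so [z = 0] is excluded separately, by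
   injectivity of [L] and [M]. *)
have [z0|z0] := eqVneq z 0.
  move/eqP: psim; apply; apply: (@Theta_sum_eq0 _ alpha _ 1 alpha1) => // k.
  by apply: (@Theta_sum_eq0 _ alpha _ 0 alpha1) => // n; have := eig n; rewrite z0 mul0r.
pose w := sqrtC z.
have w0 : w != 0 by rewrite sqrtC_eq0.
have eigw n : extended_CMV alpha psi n = w ^+ 2 * psi n by rewrite sqrtCK eig.
move/eqP: psim; apply; apply: (@Szego_vec_eq0 _ w alpha) => //.
apply: (@Gordon_three_block _ (fun n => Szego_mx w (alpha n))).
- by move=> n; exact: det_Szego_mx.
- exact: Szego_vecS.
- move=> e /(vanishing_Szego_vec w0 alpha1 (ell2_vanishing psi2))[N HN].
  by exists N => n /HN; rewrite ger0_norm // l1norm_ge0.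
- move=> N; have [q Nq perq] := per N; exists q => // n nq.
  by rewrite perq.
Qed.

(** * Continued fractions *)

Section convergents.
Variable a : nat -> nat.

(* [cf_rec x y n] is the pair of terms [n - 1] and [n] of the sequence with
   terms [x] and [y] at [-1] and [0]. *)
Fixpoint cf_rec (x y n : nat) : nat * nat :=
  if n is n'.+1 then
    let s := cf_rec x y n' in (s.2, a n * s.2 + s.1)%N
  else (x, y).

Definition cf_num n := (cf_rec 1 0 n).2.
Definition cf_den n := (cf_rec 0 1 n).2.

Lemma cf_numS n : cf_num n.+2 = (a n.+2 * cf_num n.+1 + cf_num n)%N.
Proof. by []. Qed.

Lemma cf_denS n : cf_den n.+2 = (a n.+2 * cf_den n.+1 + cf_den n)%N.
Proof. by []. Qed.

Lemma cf_det n :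
  `|(cf_num n.+1)%:Z * (cf_den n)%:Z - (cf_den n.+1)%:Z * (cf_num n)%:Z| = 1.
Proof.
elim: n => [|n IH]; first by rewrite /cf_num /cf_den /= muln0 addn0 mulr0 subr0.
rewrite cf_numS cf_denS.
move: IH; move: (cf_num n.+1) (cf_num n) (cf_den n.+1) (cf_den n) => p' p q' q IH.
by rewrite !PoszD !PoszM -[RHS]IH -[RHS]normrN; congr `|_|; ring.
Qed.

Hypothesis a_gt0 : forall j, (0 < j)%N -> (0 < a j)%N.

Lemma cf_den_gt0 n : (0 < cf_den n)%N.
Proof.
elim/ltn_ind: n => -[|[|n]] IH //; first by rewrite /cf_den /= muln1 addn0 a_gt0.
by rewrite cf_denS addn_gt0 IH ?orbT.
Qed.

Lemma cf_den_ge n : (n <= cf_den n)%N.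
Proof.
elim: n => [//|[|n] IH]; first exact: cf_den_gt0.
rewrite cf_denS; have := cf_den_gt0 n; have := a_gt0 (ltn0Sn n.+1); nia.
Qed.

Lemma coprime_cf n : coprime (cf_num n) (cf_den n).
Proof.
rewrite /coprime -dvdn1; set g := gcdn _ _.
have dn : (g%:Z %| (cf_num n)%:Z)%Z by rewrite dvdzE /= dvdn_gcdl.
have dd : (g%:Z %| (cf_den n)%:Z)%Z by rewrite dvdzE /= dvdn_gcdr.
have := cf_det n; rewrite -abszE => -[<-].
change (g%:Z %| (cf_num n.+1)%:Z * (cf_den n)%:Z - (cf_den n.+1)%:Z * (cf_num n)%:Z)%Z.
by rewrite rpredB // dvdz_mull.
Qed.

(** As functions of [m], the cross difference and [cf_den (k + m)] obey the same recurrence. The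
    former has absolute values 0 and 1 at [m = 0, 1], so the bound propagates by the triangle
    inequality. *)
Lemma cf_cross k m :
  `|(cf_num (k + m))%:Z * (cf_den k)%:Z - (cf_den (k + m))%:Z * (cf_num k)%:Z|
    * (cf_den k.+1)%:Z <= (cf_den (k + m))%:Z.
Proof.
elim/ltn_ind: m => -[|[|m]] IH.
- by rewrite addn0 [X in _ - X]mulrC subrr normr0 mul0r.
- by rewrite addn1 cf_det mul1r.
- rewrite 2!addnS cf_numS cf_denS.
  have := IH m.+1 (ltnSn _); have := IH m (ltnW (ltnSn _)); rewrite addnS.
  move: (cf_num (k + m)) (cf_den (k + m)) (cf_num (k + m).+1) (cf_den (k + m).+1).
  move: (cf_num k) (cf_den k) (cf_den k.+1) => pk qk qk1 p q p' q' h1 h2.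
  rewrite !PoszD !PoszM (_ : _ - _ = (a (k + m).+2)%:Z * (p'%:Z * qk%:Z - q'%:Z * pk%:Z)
                       + (p%:Z * qk%:Z - q%:Z * pk%:Z)); last by ring.
  apply: (le_trans (ler_wpM2r _ (ler_normD _ _))); first by lia.
  rewrite mulrDl lerD // normrM -mulrA ler_wpM2l //.
Qed.

Variable R : realType.

Lemma contfrac_ge0 s : 0 <= contfrac R s.
Proof. by elim: s => [|b s IH] //=; rewrite invr_ge0 addr_ge0. Qed.

(** The left side is the Moebius map built from the first [n] quotients, applied to the tail [c].
    The induction moves the head of the tail into the map, reconciling [contfrac], which unfolds
    from the head, with the recurrence, which extends at the end. *)
Lemma contfrac_iotaE m n :
  let c := contfrac R [seq a j | j <- iota n.+1 m] in
  ((cf_rec 1 0 n).2%:R + (cf_rec 1 0 n).1%:R * c) /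
  ((cf_rec 0 1 n).2%:R + (cf_rec 0 1 n).1%:R * c) =
  (cf_num (n + m))%:R / (cf_den (n + m))%:R :> R.
Proof.
elim: m n => [|m IH] n /=; first by rewrite !mulr0 !addr0 addn0.
rewrite addnS -addSn -IH /=; set c := contfrac _ _.
have c0 : 0 <= c by exact: contfrac_ge0.
have a0 : 0 < (a n.+1)%:R :> R by rewrite ltr0n a_gt0.
have q0 : 0 < (cf_rec 0 1 n).2%:R :> R by rewrite ltr0n; exact: cf_den_gt0.
have ac : 0 < (a n.+1)%:R + c by lra.
have den0 : 0 < (cf_rec 0 1 n).2%:R * ((a n.+1)%:R + c) + (cf_rec 0 1 n).1%:R.
  by rewrite ltr_wpDr // mulr_gt0.
move: q0 den0; case: (cf_rec 0 1 n) (cf_rec 1 0 n) => [q' q] [p' p] /= q0 den0.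
rewrite !natrD !natrM; field; rewrite (lt0r_neq0 ac) andbT lt0r_neq0 //.
by move: den0; rewrite mulrDr addrAC mulrC.
Qed.

Lemma contfracE n :
  contfrac R [seq a j | j <- iota 1 n] = (cf_num n)%:R / (cf_den n)%:R.
Proof.
by rewrite -[n in RHS]add0n -contfrac_iotaE /= mul0r addr0 add0r mul1r divr1.
Qed.

(** Replace [theta] by a late convergent [p / q]: [cf_cross] bounds the main term, and the error
    [q_k |theta - p / q|] is at most any given [e]. *)
Lemma cf_approx (theta : R) k :
  (fun n => contfrac R [seq a j | j <- iota 1 n]) @ \oo --> theta ->
  `|(cf_den k)%:R * theta - (cf_num k)%:R| <= (cf_den k.+1)%:R^-1.
Proof.
move=> cvg_th; apply/ler_addgt0Pr => e e0.
have qk0 : 0 < (cf_den k)%:R :> R by rewrite ltr0n cf_den_gt0.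
have qk1 : 0 < (cf_den k.+1)%:R :> R by rewrite ltr0n cf_den_gt0.
have [N _ HN] := (cvgrPdist_lt _ _).1 cvg_th _ (divr_gt0 e0 qk0).
have := HN (k + N)%N; rewrite /= leq_addl contfracE => /(_ isT).
set p := cf_num _; set q := cf_den _ => h.
have q0 : 0 < q%:R :> R by rewrite ltr0n cf_den_gt0.
have := cf_cross k N; rewrite -/p -/q.
rewrite -(ler_int R) rmorphM /= intr_norm rmorphB !rmorphM /= -!pmulrn => hx.
rewrite (_ : _ - _ = (p%:R * (cf_den k)%:R - q%:R * (cf_num k)%:R) / q%:R
                     + (cf_den k)%:R * (theta - p%:R / q%:R)); last first.
  by field; rewrite gt_eqF.
apply: (le_trans (ler_normD _ _)); apply: lerD.
- rewrite normrM normfV (gtr0_norm q0) ler_pdivrMr // [leRHS]mulrC ler_pdivlMr //.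
- rewrite normrM (gtr0_norm qk0) -ler_pdivlMl // [leRHS]mulrC; exact: ltW.
Qed.

End convergents.

(** Otherwise the supremum over the tail from [N] is at most [m], and it is one of the terms of the
    infimum defining the upper limit. *)
Lemma limn_esup_frequently (R : realType) (a : nat -> nat) (m : nat) :
  (m.+1%:R%:E <= limn_esup (fun j => (a j)%:R%:E : \bar R))%E ->
  forall N, exists2 j, (N <= j)%N & (m < a j)%N.
Proof.
move=> lim_a N; apply: contrapT => no.
have am j : (N <= j)%N -> (a j <= m)%N.
  by move=> Nj; rewrite leqNgt; apply/negP => aj; apply: no; exists j.
suff : (m.+1%:R%:E <= m%:R%:E :> \bar R)%E by rewrite lee_fin ler_nat ltnn.
apply: le_trans lim_a _; apply: le_trans (ereal_inf_lbound _) _.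
  by exists [set j | (N <= j)%N] => //; exists N.
by apply: ge_ereal_sup => _ [j Nj <-]; rewrite lee_fin ler_nat am.
Qed.

(* The margin below 1/4: if a_(k+1) >= 5 then q_k / q_(k+1) <= 1/5, and if
   a_(k+1) >= 4 while a_k <= 4 then q_k <= 5 q_(k-1), so that
   q_(k+1) >= 4 q_k + q_(k-1) >= (21/5) q_k. *)
Lemma frequently_good_approx (R : realType) (theta : R) (a : nat -> nat) :
  has_contfrac_expansion theta a ->
  (4%:R%:E <= limn_esup (fun j => (a j)%:R%:E : \bar R))%E ->
  forall N : nat, exists p q : nat, [/\ (N <= q)%N, (0 < q)%N, coprime p q &
    q%:R * `|q%:R * theta - p%:R| <= 5 / 21].
Proof.
move=> [a_gt0 cvg_th] /limn_esup_frequently a4 N.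
suff [k Nk ratio] : exists2 k, (N <= k)%N & (21 * cf_den a k <= 5 * cf_den a k.+1)%N.
  exists (cf_num a k), (cf_den a k); split.
  - exact: leq_trans Nk (cf_den_ge a_gt0 k).
  - exact: cf_den_gt0.
  - exact: coprime_cf.
  - have q0 := cf_den_gt0 a_gt0 k; have q1 := cf_den_gt0 a_gt0 k.+1.
    apply: (le_trans (ler_wpM2l (ler0n _ _) (cf_approx a_gt0 k cvg_th))).
    rewrite ler_pdivrMr ?ltr0n // mulrAC ler_pdivlMr ?ltr0n //.
    by rewrite -!natrM ler_nat mulnC.
have [[k Nk ak]|no5] := pselect (exists2 k, (N <= k)%N & (4 < a k.+1)%N).
  exists k => //; have := cf_den_gt0 a_gt0 k.
  case: k {Nk} ak => [|k] ak; first by rewrite /cf_den /= ; nia.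
  by rewrite cf_denS; nia.
(* Starting at [N.+2] puts the preceding quotient [a k.+1] within the range where [no5] bounds it by
   4. *)
have [[//|[//|k]] Nk ak] := a4 N.+2.
exists k.+1; first by lia.
have ak1 : (a k.+1 <= 4)%N.
  rewrite leqNgt; apply/negP => ak1; apply: no5; exists k => //; lia.
have ak0 := a_gt0 k.+1 isT.
rewrite cf_denS; case: k Nk ak ak1 ak0 => [|k] Nk ak ak1 ak0.
  by rewrite /cf_den /= muln1 addn0; nia.
rewrite cf_denS.
have q0 := cf_den_gt0 a_gt0 k.+1.
have qle : (cf_den a k <= cf_den a k.+1)%N.
  case: k {Nk ak ak1 ak0} q0 => [|k] q0 //; rewrite cf_denS.
  by have := a_gt0 k.+2 isT; nia.
nia.
Qed.

(** * Lebesgue outer measure and rotations *)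

Section outer_lebesgue.
Variable R : realType.
Implicit Types (A B : set R) (x y : R).

(** The outer measure is defined on every set, so sets of bad phases can be estimated directly. *)
Definition outer_lebesgue A : \bar R := ((@wlength R idfun)^* A)%mu.

Lemma le_outer_lebesgue A B : A `<=` B -> (outer_lebesgue A <= outer_lebesgue B)%E.
Proof. by move=> AB; rewrite /outer_lebesgue; apply: le_outer_measure. Qed.

Lemma outer_lebesgueU A B :
  (outer_lebesgue (A `|` B) <= outer_lebesgue A + outer_lebesgue B)%E.
Proof. by rewrite /outer_lebesgue; apply: outer_measureU2. Qed.

Lemma outer_lebesgue_itv x y : x <= y -> outer_lebesgue `[x, y] = (y - x)%:E.
Proof.
move=> xy; rewrite -[LHS]/(lebesgue_measure `[x, y]%classic) lebesgue_measure_itv /=.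
by rewrite lte_fin; case: ltgtP xy => // -> _; rewrite subrr.
Qed.

Lemma outer_lebesgue_cover_le A (e : R) : 0 < e -> (outer_lebesgue A < +oo)%E ->
  exists2 F : (set R)^nat, open_itv_cover A F &
  (\sum_(k <oo) wlength idfun (F k) <= outer_lebesgue A + e%:E)%E.
Proof.
move=> e0 Aoo; have : outer_lebesgue A \is a fin_num.
  by rewrite ge0_fin_numE ?outer_measure_ge0.
rewrite /outer_lebesgue outer_measure_open_itv_cover.
move=> /lb_ereal_inf_adherent-/(_ _ e0)[_/= [F]] AF <- Fe.
by exists F => //; exact/ltW.
Qed.

(* Cover [A] by intervals of total length at most [outer_lebesgue A + e]: the
   hypothesis on each of them gives
   [outer_lebesgue A <= k * (outer_lebesgue A + e)]. *)
Lemma outer_lebesgue_density_eq0 A (k : R) : 0 <= k < 1 ->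
  (outer_lebesgue A < +oo)%E ->
  (forall x y, x <= y -> (outer_lebesgue (A `&` `[x, y]) <= (k * (y - x))%:E)%E) ->
  outer_lebesgue A = 0%E.
Proof.
move=> /andP[k0 k1] Aoo dens.
have Afin : outer_lebesgue A \is a fin_num by rewrite ge0_fin_numE ?outer_measure_ge0.
have A0 : (0 <= outer_lebesgue A)%E by exact: outer_measure_ge0.
have key (e : R) : 0 < e -> (outer_lebesgue A <= k%:E * (outer_lebesgue A + e%:E))%E.
  move=> e0; have [F [Fitv AF] Fe] := outer_lebesgue_cover_le e0 Aoo.
  apply: (@le_trans _ _ (\sum_(j <oo) outer_lebesgue (A `&` F j))%E).
    rewrite -{1}(setIidl AF) setI_bigcupr /outer_lebesgue.
    exact: outer_measure_sigma_subadditive.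
  have l0 j : (0 <= wlength idfun (F j))%E.
    by case: (Fitv j) => -[u v] -> /=; exact: wlength_ge0.
  apply: (@le_trans _ _ (\sum_(j <oo) (k%:E * wlength idfun (F j)))%E).
    apply: lee_nneseries => [j _ _|j _]; first exact: outer_measure_ge0.
    case: (Fitv j) => -[u v] -> /=.
    have [uv|vu] := ltP u v.
      rewrite wlength_itv /= lte_fin uv -EFinB -EFinM.
      apply: le_trans (dens _ _ (ltW uv)); apply: le_outer_lebesgue.
      by apply: setIS; exact: subset_itv_oo_cc.
    rewrite set_itv_ge ?bnd_simp -?leNgt // setI0 wlength0 mule0.
    by rewrite /outer_lebesgue outer_measure0.
  by rewrite nneseriesZl // lee_wpmul2l.
move: A0 key; rewrite -(fineK Afin) lee_fin; set d := fine _ => d0 key.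
congr (_%:E); apply/eqP; rewrite eq_le d0 andbT leNgt; apply/negP => dgt0.
(* For this [e], the bound [d <= k (d + e)] would give [(1 - k) d <= (1 - k) d / 2]. *)
have e0 : 0 < (1 - k) * d / 2 by rewrite divr_gt0 // mulr_gt0 // subr_gt0.
have := key _ e0; rewrite -EFinD -EFinM lee_fin => h.
have : k * ((1 - k) * d / 2) <= 1 * ((1 - k) * d / 2) by rewrite ler_wpM2r // ltW.
by lra.
Qed.

(** Cutting [A] by the intervals [[-n, n]] provides the finite outer measure that the previous
    estimate requires. *)
Lemma negligible_density A (k : R) : 0 <= k < 1 ->
  (forall x y, x <= y -> (outer_lebesgue (A `&` `[x, y]) <= (k * (y - x))%:E)%E) ->
  (@lebesgue_measure R).-negligible A.
Proof.
move=> k01 dens.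
pose E (n : nat) : set R := `[- n%:R, n%:R]%classic.
have -> : A = \bigcup_n (A `&` E n).
  apply/seteqP; split=> [x Ax|x [n _ []]//].
  exists (Num.Def.truncn `|x|).+1 => //; split => //.
  by rewrite /E /= in_itv /= -ler_norml ltW // truncnS_gt.
apply: negligible_bigcup => n; apply/negligible_outer_measure.
apply: (@outer_lebesgue_density_eq0 _ k) => //.
- have nn : - n%:R <= n%:R :> R by rewrite (@le_trans _ _ 0) // oppr_le0.
  by apply: le_lt_trans (dens _ _ nn) _; rewrite ltry.
- move=> x y xy; apply: le_trans (dens _ _ xy).
  by apply: le_outer_lebesgue; rewrite setIAC; exact: subIsetl.
Qed.

Lemma outer_lebesgue_finite_cover A (F : nat -> set R) (N : nat) (d : R) :
  A `<=` (fun x => exists2 j, (j < N)%N & F j x) ->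
  (forall j, (outer_lebesgue (F j) <= d%:E)%E) ->
  (outer_lebesgue A <= (N%:R * d)%:E)%E.
Proof.
move=> AF Fd.
apply: (@le_trans _ _ (outer_lebesgue (\big[setU/set0]_(j < N) F j))).
  by apply: le_outer_lebesgue => x /AF[j jN Fx]; rewrite -bigcup_mkord; exists j.
apply: le_trans (outer_measure_subadditive _ _ _) _.
apply: (@le_trans _ _ (\sum_(j < N) d%:E)%E); first by apply: lee_sum => j _; exact: Fd.
by rewrite sumEFin sumr_const card_ord mulr_natl.
Qed.

(** The center [c] is approached modulo 1, [m] being the integer part to remove. A window of exactly
    [q] indices contains each residue modulo [q] once; the range [- q < n <= q] splits into the
    windows [s = - q] and [s = 0]. *)
Definition rotation_near (theta c : R) (p q : nat) (s : int) : set R :=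
  [set phi | exists n m : int, s < n <= s + q%:Z /\
    `|phi + n%:~R * theta - m%:~R - c| <= `|q%:R * theta - p%:R| / 2].

(* By coprimality the points [c + m - n theta] are indexed by the integers
   [t = m q - n p], and each lies within [1 / q] of [c + t / q]: so at most
   [q (y - x) + 3] of them matter for [`[x, y]]. *)
Lemma rational_rotation_cover (theta c : R) (p q : nat) (s : int) x y :
  (0 < q)%N -> coprime p q -> - q%:Z <= s <= 0 ->
  q%:R * `|q%:R * theta - p%:R| <= 5 / 21 -> x <= y ->
  (outer_lebesgue (rotation_near theta c p q s `&` `[x, y]) <=
    ((q%:R * (y - x) + 3) * `|q%:R * theta - p%:R|)%:E)%E.
Proof.
move=> q0 pq sq; set dl := q%:R * theta - p%:R => small xy.
have dl0 : 0 <= `|dl| by [].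
have qr0 : 0 < q%:R :> R by rewrite ltr0n.
pose t0 : int := Num.floor (q%:R * (x - c)).
(* The relevant integers [t] satisfy [t0 <= t < t0 + q (y - x) + 2]. *)
pose N : nat := (Num.Def.truncn (q%:R * (y - x) + 2)).+1.
pose F (j : nat) : set R := [set phi | exists n m : int,
  [/\ s < n <= s + q%:Z, m * q%:Z - n * p%:Z = t0 + j%:Z &
      `|phi + n%:~R * theta - m%:~R - c| <= `|dl| / 2]].
have L0 : 0 <= q%:R * (y - x) + 2 by rewrite addr_ge0 // mulr_ge0 ?subr_ge0.
apply: (@le_trans _ _ (N%:R * `|dl|)%:E); last first.
  rewrite lee_fin ler_wpM2r // /N -addn1 natrD.
  have : (Num.Def.truncn (q%:R * (y - x) + 2))%:R <= q%:R * (y - x) + 2 by rewrite truncn_le.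
  lra.
apply: (@outer_lebesgue_finite_cover _ F) => [phi /= [[n [m [nq near_phi]]] phixy]|j].
- pose t : int := m * q%:Z - n * p%:Z.
  (* Since [|n| <= q], the distance is at most [3/2 * 5/21], the half coming from closeness to [c]
     and the rest from [n (q theta - p)]. *)
  have near_t : `|q%:R * (phi - c) - t%:~R| < 1.
    have -> : q%:R * (phi - c) - t%:~R =
        q%:R * (phi + n%:~R * theta - m%:~R - c) - n%:~R * dl :> R.
      by rewrite /t /dl rmorphB !rmorphM /= -!pmulrn; ring.
    apply: (le_lt_trans (ler_normB _ _)); rewrite !normrM (gtr0_norm qr0).
    have nle : `|n%:~R| <= q%:R :> R.
      rewrite -intr_norm pmulrn ler_int; lia.
    have h1 : q%:R * `|phi + n%:~R * theta - m%:~R - c| <= q%:R * (`|dl| / 2).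
      by rewrite ler_wpM2l // ltW.
    have h2 : `|n%:~R| * `|dl| <= q%:R * `|dl| by rewrite ler_wpM2r.
    by lra.
  move: phixy; rewrite in_itv /= => /andP[xphi phiy].
  have h1 : q%:R * (x - c) <= q%:R * (phi - c) by rewrite ler_pM2l // lerD2r.
  have h2 : q%:R * (phi - c) <= q%:R * (y - c) by rewrite ler_pM2l // lerD2r.
  have t0le : t0%:~R <= q%:R * (x - c) by exact: floor_le.
  have t0gt : q%:R * (x - c) < (t0 + 1)%:~R by exact: floorD1_gt.
  move: near_t; rewrite ltr_norml => /andP[n1 n2].
  have tt0 : t0 <= t.
    rewrite -ltzD1 -(ltr_int R) rmorphD /=; lra.
  exists `|t - t0|%N.
    rewrite /N ltnS.
    rewrite -ltnS -(ltr_nat R) (@le_lt_trans _ _ (q%:R * (y - x) + 2)) //.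
      rewrite -[_%:R]/(`|t - t0|%N%:Z%:~R) gez0_abs ?subr_ge0 // rmorphB /=.
      move: t0gt; rewrite rmorphD /=; lra.
    exact: truncnS_gt.
  by exists n, m; split; rewrite // -/t gez0_abs ?subr_ge0 // [t0 + _]addrC subrK.
- have [Fj0|/set0P[phi0 [n [m [nq tE _]]]]] := eqVneq (F j) set0.
    by rewrite Fj0 /outer_lebesgue outer_measure0 lee_fin.
  pose e := m%:~R + c - n%:~R * theta.
  apply: (@le_trans _ _ (outer_lebesgue `[e - `|dl| / 2, e + `|dl| / 2])).
    apply: le_outer_lebesgue => phi [n' [m' [nq' tE' near_phi]]].
    have [nn mm] : n' = n /\ m' = m.
      (* Equal values of [t] force [q] to divide [n - n'], and both indices lie in one window of
         length [q]; hence [F j] lies in a single interval of length [|dl|]. *)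
      have dq : (q%:Z %| (n - n') * p%:Z)%Z.
        have -> : (n - n') * p%:Z = (m - m') * q%:Z by lia.
        exact: dvdz_mull.
      move: dq; rewrite Gauss_dvdzl; last by rewrite coprimezE /= coprime_sym.
      move=> /dvdzP[k kE].
      have k0 : k = 0 by nia.
      have nn : n' = n by lia.
      by split => //; subst n'; nia.
    move: near_phi; rewrite nn mm /= in_itv /= ler_norml /e; lra.
  by rewrite outer_lebesgue_itv ?lee_fin; lra.
Qed.

End outer_lebesgue.

(** * Periodicity of the coding away from the endpoints of the interval *)

Section coding.
Variable R : realType.
Implicit Types (x y theta phi : R) (I J : set R).

(** An endpoint of [J] separates a point inside from a point outside, so it is within half their
    distance of their midpoint. *)
Lemma interval_endpoints J : is_interval J ->
  exists e : bool -> R, forall x y, J x -> ~ J y ->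
    exists i, `|(x + y) / 2 - e i| <= `|y - x| / 2.
Proof.
(* [sup J] is used only when [y] bounds [J] above, and [inf J] only when [y] bounds it below, so
   default values on an unbounded side never matter. *)
move=> itvJ; exists (fun i : bool => if i then sup J else inf J) => x y Jx nJy.
have [xy|yx] := leP x y.
- exists true; have ubJ : ubound J y.
    move=> z Jz; rewrite leNgt; apply/negP => yz; apply: nJy.
    by apply: (itvJ x z) => //; rewrite xy ltW.
  have h1 : sup J <= y by apply: ge_sup => //; exists x.
  have h2 : x <= sup J by apply: ub_le_sup => //; exists y.
  by rewrite (ger0_norm (_ : 0 <= y - x)) ?subr_ge0 // ler_norml; lra.
- exists false; have lbJ : lbound J y.
    move=> z Jz; rewrite leNgt; apply/negP => zy; apply: nJy.
    by apply: (itvJ z x) => //; rewrite !ltW.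
  have h1 : y <= inf J by apply: lb_le_inf => //; exists x.
  have h2 : inf J <= x by apply: ge_inf => //; exists y.
  have yx0 : y - x <= 0 by rewrite subr_le0 ltW.
  by rewrite (ler0_norm yx0) ler_norml; lra.
Qed.

Lemma mod1_imageP J x : (@mod1 R @` J) (mod1 x) <-> exists m : int, J (x - m%:~R).
Proof.
split=> [[y Jy]|[m Jx]].
- rewrite /mod1 => E; exists (Num.floor x - Num.floor y).
  rewrite (_ : _ - _ = y) // rmorphB /=; lra.
- exists (x - m%:~R) => //; rewrite /mod1 -rmorphN /= floorDrz ?intr_int //.
  by rewrite intrKfloor rmorphD /= rmorphN /=; ring.
Qed.

(** Modulo 1, going from [n] to [n + q] moves the point by [dl = q theta - p]. If the coding
    changes, an endpoint lies within [|dl| / 2] of the midpoint of this move; the shift by [dl / 2]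
    in [c i] places that midpoint. *)
Lemma rotation_coding_periodic theta phi I J (e : bool -> R) (p q : nat) :
  I = @mod1 R @` J ->
  (forall x y, J x -> ~ J y -> exists i, `|(x + y) / 2 - e i| <= `|y - x| / 2) ->
  let c i := e i - (q%:R * theta - p%:R) / 2 in
  (forall i s, s \in [:: - q%:Z; 0] -> ~ rotation_near theta (c i) p q s phi) ->
  forall n : int, - q%:Z < n <= q%:Z ->
    rotation_coding theta phi I (n + q%:Z) = rotation_coding theta phi I n.
Proof.
move=> IJ He c far n nq; pose dl := q%:R * theta - p%:R.
have [s ss ns] : exists2 s : int, s \in [:: - q%:Z; 0] & s < n <= s + q%:Z.
  have [n0|n0] := leP n 0; [exists (- q%:Z)|exists 0]; rewrite ?inE ?eqxx ?orbT //; lia.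
pose x := n%:~R * theta + phi.
have xq : (n + q%:Z)%:~R * theta + phi = x + dl + p%:R.
  by rewrite rmorphD /= -pmulrn /x /dl; ring.
have nocross m : J (x - m%:~R) <-> J (x + dl - m%:~R).
  have off i : ~ `|x + dl / 2 - m%:~R - e i| <= `|dl| / 2.
    move=> near_e; apply: (far i s ss); exists n, m; split => //.
    by rewrite (_ : _ - _ = x + dl / 2 - m%:~R - e i) // /c /x -/dl; ring.
  split=> Jx; apply: contrapT => nJ.
  - have [i ] := He _ _ Jx nJ.
    rewrite (_ : _ / 2 - _ = x + dl / 2 - m%:~R - e i); last by field.
    by rewrite (_ : x + dl - _ - _ = dl); [exact: off|ring].
  - have [i ] := He _ _ Jx nJ.
    rewrite (_ : _ / 2 - _ = x + dl / 2 - m%:~R - e i); last by field.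
    by rewrite (_ : x - _ - (x + dl - _) = - dl); [rewrite normrN; exact: off|ring].
rewrite /rotation_coding xq -/x IJ !indicE; congr ((nat_of_bool _)%:R).
apply/idP/idP => /set_mem/mod1_imageP[m Jm]; apply/mem_set/mod1_imageP.
- by exists (m - p%:Z); apply/nocross; move: Jm; rewrite rmorphB /= -pmulrn;
    congr (J _); ring.
- by exists (m + p%:Z); move/nocross: Jm; rewrite rmorphD /= -pmulrn; congr (J _); ring.
Qed.

End coding.

(** * From local density estimates to almost every phase *)

Lemma negligible_recurrent_near (R : realType) (theta : R) (e : bool -> R)
    (good : nat -> nat -> Prop) :
  (forall p q, good p q -> [/\ (0 < q)%N, coprime p q &
     q%:R * `|q%:R * theta - p%:R| <= 5 / 21]) ->
  (forall N, exists p q, (N <= q)%N /\ good p q) ->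
  forall N, (@lebesgue_measure R).-negligible [set phi | forall p q, (N <= q)%N ->
    good p q -> exists i s, s \in [:: - q%:Z; 0] /\
      rotation_near theta (e i - (q%:R * theta - p%:R) / 2) p q s phi].
Proof.
move=> good_approx freq N; set A := [set phi | _].
(* Two endpoints and two windows give four sets, each of density at most [5 / 21] up to an error:
   [4 * 5 / 21 = 20 / 21]. *)
apply: (@negligible_density _ _ (20 / 21)) => [|x y xy]; first by apply/andP; split; lra.
have yx0 : 0 <= y - x by rewrite subr_ge0.
apply/lee_addgt0Pr => eps eps0.
(* The four additive terms [3 dl] total [12 dl]; since [q dl <= 5 / 21], taking [q > 3 / eps] keeps
   this below [eps]. *)
have [p [q [Nq gpq]]] := freq (maxn N (Num.Def.truncn (3 / eps)).+1).
have [q0 cop small] := good_approx _ _ gpq.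
move: Nq; rewrite geq_max => /andP[Nq epsq].
set dl := `|q%:R * theta - p%:R| in small *.
have qr0 : 0 < q%:R :> R by rewrite ltr0n.
have dl_eps : dl * 12 <= eps.
  have : 3 / eps < q%:R.
    by apply: (lt_le_trans (truncnS_gt _)); rewrite ler_nat.
  rewrite ltr_pdivrMr // => h.
  have h2 : q%:R * (dl * 12) <= q%:R * eps by lra.
  by move: h2; rewrite ler_pM2l.
pose T i s := rotation_near theta (e i - (q%:R * theta - p%:R) / 2) p q s `&` `[x, y].
pose b : R := (q%:R * (y - x) + 3) * dl.
have Tb i s : - q%:Z <= s <= 0 -> (outer_lebesgue (T i s) <= b%:E)%E.
  by move=> sq; exact: rational_rotation_cover.
have subT : A `&` `[x, y] `<=`
    (T true (- q%:Z) `|` T true 0) `|` (T false (- q%:Z) `|` T false 0).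
  move=> phi [Aphi phixy]; have [i [s [ss near_phi]]] := Aphi p q Nq gpq.
  have Tphi : T i s phi by [].
  move: ss Tphi; rewrite !inE => /orP[]/eqP-> ; case: i {near_phi} => Tphi.
  - by left; left.
  - by right; left.
  - by left; right.
  - by right; right.
apply: (le_trans (le_outer_lebesgue subT)).
apply: (@le_trans _ _ ((b + b) + (b + b))%:E).
  rewrite !EFinD; apply: (le_trans (outer_lebesgueU _ _)); apply: leeD;
  apply: (le_trans (outer_lebesgueU _ _)); apply: leeD; apply: Tb; lia.
rewrite -EFinD lee_fin /b.
have : q%:R * dl * (y - x) <= 5 / 21 * (y - x) by rewrite ler_wpM2r.
lra.
Qed.

Theorem theorem1p2 (R : realType) (theta : R) (a : nat -> nat) (I : set R)
    (beta gamma : R[i])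
    (theta01 : 0 < theta < 1) (theta_irr : irrational theta)
    (theta_cf : has_contfrac_expansion theta a)
    (I_int : nondegenerate_circle_interval I)
    (beta_disk : `|beta| < 1) (gamma_disk : `|gamma| < 1)
    (beta_gamma : beta != gamma)
    (limsup_a : (4%:R%:E <= limn_esup (fun j => (a j)%:R%:E : \bar R))%E) :
  {ae (@lebesgue_measure R), forall phi : R, 0 <= phi < 1 ->
    purely_continuous_spectrum
      (extended_CMV (coding_verblunsky theta phi I beta gamma))}.
Proof.
have [J [itvJ _ IJ]] := I_int.
have [e He] := interval_endpoints itvJ.
pose good p q := [/\ (0 < q)%N, coprime p q & q%:R * `|q%:R * theta - p%:R| <= 5 / 21].
have freq N : exists p q, (N <= q)%N /\ good p q.
  by have [p [q [Nq ? ? ?]]] := frequently_good_approx theta_cf limsup_a N; exists p, q.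
(* The exceptional set is the union over [N] of the phases that are bad for every good pair with
   [q >= N]; outside it, good periods occur beyond every [N]. *)
have := negligible_bigcup (negligible_recurrent_near e (fun p q g => g) freq).
apply: negligibleS => phi /= not_pc; apply: contrapT => notin; apply: not_pc => _.
apply: Gordon_CMV => [n|N]; first by rewrite /coding_verblunsky; case: ifP.
have [p [q [Nq [gpq far]]]] : exists p q, (N <= q)%N /\ (good p q /\
    forall i s, s \in [:: - q%:Z; 0] ->
      ~ rotation_near theta (e i - (q%:R * theta - p%:R) / 2) p q s phi).
  apply: contrapT => no; apply: notin; exists N => // p q Nq gpq.
  apply: contrapT => no'; apply: no; exists p, q; do 2!split => //.
  by move=> i s ss near_phi; apply: no'; exists i, s.
exists q => // n nq.
by rewrite /coding_verblunsky (rotation_coding_periodic IJ He far).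
Qed.
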